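(* Let $(\omega,\Omega)$ be a regular almost-cosymplectic-contact structure on $M$ with dual pair $(E,\Lambda)$. A vector field $X$ on $M$ is an infinitesimal symmetry of $\omega$, i.e. $L_X\omega=0$, if and only if $X=X_{(\alpha,h)}$ for a 1-form $\alpha$ and a function $h\in C^\infty(M)$ related by $$i_{\alpha^\sharp}d\omega+h\,i_E d\omega+dh=0.$$
   Context: $M$ is a smooth manifold of dimension $2n+1$; everything is smooth. A regular almost-cosymplectic-contact structure on $M$ is a pair $(\omega,\Omega)$ of a 1-form $\omega$ and a 2-form $\Omega$ with $d\Omega=0$ and $\omega\wedge\Omega^n$ nowhere zero. Write $\Omega^\flat:TM\to T^*M$, $Y\mapsto Y^\flat=i_Y\Omega$, and for a bivector field $\Lambda$ write $\Lambda^\sharp:T^*M\to TM$, $\alpha\mapsto\alpha^\sharp=i_\alpha\Lambda$, i.e. $\beta(\alpha^\sharp)=\Lambda(\alpha,\beta)$. The dual pair $(E,\Lambda)$ is the unique pair of a vector field $E$ (the Reeb vector field) and a bivector field $\Lambda$ such that $(\Omega^\flat|_{\mathrm{Im}\,\Lambda^\sharp})^{-1}=\Lambda^\sharp|_{\mathrm{Im}\,\Omega^\flat}$, $i_E\omega=1$, $i_E\Omega=0$, $i_\omega\Lambda=0$. For a 1-form $\alpha$ and a function $h$ put $X_{(\alpha,h)}=\alpha^\sharp+hE$. Every vector field is of this form, with $h=\omega(X)$ and $\alpha$ determined up to adding a function multiple of $\omega$. $L$ denotes the Lie derivative. *)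

(* Defs.v *)
From HB Require Import structures.
From mathcomp Require Import all_boot all_order all_algebra all_fingroup.
From mathcomp Require Import all_classical all_reals all_analysis.

Set Implicit Arguments.
Unset Strict Implicit.
Unset Printing Implicit Defensive.

Import Order.TTheory GRing.Theory Num.Theory.
Import numFieldNormedType.Exports.

Local Open Scope classical_set_scope.
Local Open Scope ring_scope.

Section SmoothMaps.
Context {R : realType} {V W : normedModType R}.

Fixpoint Ck_on (k : nat) (U : set V) (f : V -> W) : Prop :=
  match k with
  | 0 => forall x, U x -> {for x, continuous f}
  | k'.+1 => (forall x, U x -> differentiable f x)
             /\ (forall v : V, Ck_on k' U ('D_v f))
  end.

Definition smooth_on (U : set V) (f : V -> W) : Prop := forall k, Ck_on k U f.

End SmoothMaps.

(* The charts form an arbitrary (not necessarily maximal) smooth atlas; the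
   values of [chart_map i] off [chart_dom i] and of [chart_inv i] off the open
   set [chart_map i @` chart_dom i] are junk. *)
Record smooth_manifold (R : realType) (m : nat) := SmoothManifold {
  carrier :> topologicalType;
  chart : Type;
  chart_dom : chart -> set carrier;
  chart_map : chart -> carrier -> 'rV[R]_m;
  chart_inv : chart -> 'rV[R]_m -> carrier;
  manifold_hausdorff : hausdorff_space carrier;
  manifold_second_countable : @second_countable carrier;
  chart_cover : forall p, exists i, chart_dom i p;
  chart_dom_open : forall i, open (chart_dom i);
  chart_img_open : forall i, open (chart_map i @` chart_dom i);
  chart_mapK : forall i p, chart_dom i p -> chart_inv i (chart_map i p) = p;
  chart_map_continuous : forall i p, chart_dom i p ->
    {for p, continuous (chart_map i)};
  chart_inv_continuous : forall i x, (chart_map i @` chart_dom i) x ->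
    {for x, continuous (chart_inv i)};
  chart_transition_smooth : forall i j,
    smooth_on (chart_map i @` (chart_dom i `&` chart_dom j))
              (chart_map j \o chart_inv i)
}.

Section Calculus.
Context {R : realType} {m : nat} (M : smooth_manifold R m).

Definition chart_img (i : chart M) : set 'rV[R]_m :=
  chart_map i @` chart_dom i.

Definition transition (i j : chart M) : 'rV[R]_m -> 'rV[R]_m :=
  chart_map j \o chart_inv i.

Definition chart_at (p : M) : chart M := projT1 (cid (chart_cover p)).

Lemma chart_atP (p : M) : chart_dom (chart_at p) p.
Proof. by rewrite /chart_at; case: cid. Qed.

(* A tangent vector at p is the family of its components in the charts around
   p, related by the differentials of the transition maps; the entries at
   charts which do not contain p are set to 0, so that two tangent vectors are
   equal as soon as they have the same components in one chart around p. *)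
Definition tangent_family (p : M) : {pred chart M -> 'rV[R]_m} :=
  fun v => `[< (forall i, ~ chart_dom i p -> v i = 0) /\
               (forall i j, chart_dom i p -> chart_dom j p ->
                  v j = 'd (transition i j) (chart_map i p) (v i)) >].

Record tangent (p : M) := Tangent {
  component :> chart M -> 'rV[R]_m;
  componentP : component \in tangent_family p
}.

HB.instance Definition _ (p : M) := [isSub for @component p].
HB.instance Definition _ (p : M) := [Choice of tangent p by <:].

Lemma tangent_family_submod (p : M) : submod_closed (tangent_family p).
Proof.
split.
  by apply/asboolP; split=> [//|i j _ _]; rewrite linear0.
move=> a u v /asboolP[u0 uE] /asboolP[v0 vE]; apply/asboolP.
have E k : (a *: u + v) k = a *: u k + v k by [].
split=> [i ip|i j ip jp]; first by rewrite E u0// v0// scaler0 addr0.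
by rewrite !E (uE i j)// (vE i j)// -linearP.
Qed.

HB.instance Definition _ (p : M) :=
  GRing.isSubmodClosed.Build R _ (tangent_family p) (tangent_family_submod p).
HB.instance Definition _ (p : M) := [SubChoice_isSubLmodule of tangent p by <:].

(* The tangent vector at p whose component in the chart i is w. *)
Definition tvec (i : chart M) (p : M) (w : 'rV[R]_m) : tangent p :=
  xget 0 [set v : tangent p | v i = w].

Lemma chart_img_nbhs (i j : chart M) (p : M) :
  chart_dom i p -> chart_dom j p ->
  \forall x \near chart_map i p, chart_img i x /\ chart_dom j (chart_inv i x).
Proof.
move=> ip jp; have ximg : chart_img i (chart_map i p) by exists p.
have xnbhs := open_nbhs_nbhs (conj (@chart_img_open _ _ M i) ximg).
have jnbhs : nbhs (chart_inv i (chart_map i p)) (chart_dom j).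
  by rewrite chart_mapK//; exact: open_nbhs_nbhs (conj (@chart_dom_open _ _ M j) jp).
exact: filterI xnbhs (chart_inv_continuous ximg jnbhs).
Qed.

Lemma transition_differentiable (i j : chart M) (p : M) :
  chart_dom i p -> chart_dom j p ->
  differentiable (transition i j) (chart_map i p).
Proof.
move=> ip jp; have [df _] := chart_transition_smooth i j 1.
by apply: df; exists p.
Qed.

Lemma transitionE (i j : chart M) (p : M) :
  chart_dom i p -> transition i j (chart_map i p) = chart_map j p.
Proof. by move=> ip; rewrite /transition /= chart_mapK. Qed.

Lemma diff_transition_id (i : chart M) (p : M) (w : 'rV[R]_m) :
  chart_dom i p -> 'd (transition i i) (chart_map i p) w = w.
Proof.
move=> ip; rewrite -deriveE; last exact: transition_differentiable.
have e : \forall x \near chart_map i p, transition i i x = x.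
  apply: filterS (chart_img_nbhs ip ip) => x -[[q iq <-] _].
  exact: transitionE.
by rewrite (near_eq_derive w (g := id) e) derive_id.
Qed.

Lemma diff_transition_comp (i j k : chart M) (p : M) (w : 'rV[R]_m) :
  chart_dom i p -> chart_dom j p -> chart_dom k p ->
  'd (transition i k) (chart_map i p) w =
  'd (transition j k) (chart_map j p) ('d (transition i j) (chart_map i p) w).
Proof.
move=> ip jp kp.
have dij := transition_differentiable ip jp.
have djk : differentiable (transition j k) (transition i j (chart_map i p)).
  by rewrite (transitionE j ip); exact: transition_differentiable.
have e : \forall x \near chart_map i p,
    transition i k x = (transition j k \o transition i j) x.
  apply: filterS (chart_img_nbhs ip jp) => x -[_ jx].
  by rewrite /transition /= chart_mapK.
have d1 := deriveE w (transition_differentiable ip kp).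
have d2 := deriveE w (differentiable_comp dij djk).
have /(congr1 (@^~ w)) d3 := diff_comp dij djk.
rewrite -(transitionE j ip).
exact: etrans (esym d1) (etrans (near_eq_derive w e) (etrans d2 d3)).
Qed.

Lemma tvecK (i : chart M) (p : M) (w : 'rV[R]_m) :
  chart_dom i p -> tvec i p w i = w.
Proof.
move=> ip.
pose f j : 'rV[R]_m := if pselect (chart_dom j p)
  then 'd (transition i j) (chart_map i p) w else 0.
have fE l : chart_dom l p -> f l = 'd (transition i l) (chart_map i p) w.
  by rewrite /f; case: pselect.
have fP : f \in tangent_family p.
  apply/asboolP; split=> [j jp|j k jp kp]; first by rewrite /f; case: pselect.
  by rewrite fE// fE//; exact: diff_transition_comp.
rewrite /tvec; case: xgetP => [v _ //|/(_ (Tangent fP))] /=.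
by rewrite fE// diff_transition_id.
Qed.

Lemma tangent_inj (i : chart M) (p : M) (u v : tangent p) :
  chart_dom i p -> u i = v i -> u = v.
Proof.
move=> ip uv; apply/val_inj/funext => j /=.
case: u v uv => u /= /asboolP[u0 uE] [v /= /asboolP[v0 vE]] uv.
have [jp|jp] := pselect (chart_dom j p); last by rewrite u0// v0.
by rewrite (uE i j)// (vE i j)// uv.
Qed.

Lemma tangent_expand (i : chart M) (p : M) (u : tangent p) :
  chart_dom i p ->
  u = \sum_j u i ord0 j *: tvec i p (delta_mx ord0 j).
Proof.
move=> ip; apply: (tangent_inj ip).
have -> : (\sum_j u i ord0 j *: tvec i p (delta_mx ord0 j) : tangent p) i =
  \sum_j u i ord0 j *: tvec i p (delta_mx ord0 j) i.
  by apply: (big_morph (fun v : tangent p => v i)).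
rewrite {1}[u i]row_sum_delta.
by apply: eq_bigr => j _; rewrite tvecK.
Qed.

Lemma scalar_expand (i : chart M) (p : M) (b : tangent p -> R) (u : tangent p) :
  chart_dom i p -> scalar b ->
  b u = \sum_j u i ord0 j * b (tvec i p (delta_mx ord0 j)).
Proof.
move=> ip sb; rewrite {1}(tangent_expand u ip).
have b0 : b 0 = 0 by have := sb (-1) 0 0; rewrite scaler0 addr0 mulN1r addNr.
have bD : {morph b : x y / x + y} by move=> x y; have := sb 1 x y; rewrite scale1r mul1r.
rewrite (big_morph b bD b0); apply: eq_bigr => j _.
by have := sb (u i ord0 j) (tvec i p (delta_mx ord0 j)) 0; rewrite !addr0 b0 addr0.
Qed.

Definition smooth_fun (h : M -> R) : Prop :=
  forall i, smooth_on (chart_img i) (h \o chart_inv i).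

Definition vfield := forall p : M, tangent p.

Definition vfield_in (i : chart M) (X : vfield) (x : 'rV[R]_m) : 'rV[R]_m :=
  X (chart_inv i x) i.

Definition smooth_vfield (X : vfield) : Prop :=
  forall i, smooth_on (chart_img i) (vfield_in i X).

(* Fields of functions of k tangent vectors; the differential k-forms are those
   which satisfy [is_form]. *)
Definition kfield (k : nat) := forall p : M, ('I_k -> tangent p) -> R.

Definition kfield_in k (i : chart M) (w : kfield k) (x : 'rV[R]_m)
    (v : 'I_k -> 'rV[R]_m) : R :=
  w (chart_inv i x) (fun a => tvec i (chart_inv i x) (v a)).

Definition is_form k (w : kfield k) : Prop :=
  [/\ forall p (v : 'I_k -> tangent p) a (c : R) (x y : tangent p),
        w p [eta v with a |-> c *: x + y]
        = c * w p [eta v with a |-> x] + w p [eta v with a |-> y],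
      forall p (v : 'I_k -> tangent p) a b, a != b -> v a = v b -> w p v = 0 &
      forall i (v : 'I_k -> 'rV[R]_m),
        smooth_on (chart_img i) (fun x => kfield_in i w x v)].

Definition fun_form (h : M -> R) : kfield 0 := fun p _ => h p.

Definition vcons (p : M) k (x : tangent p) (v : 'I_k -> tangent p) :
    'I_k.+1 -> tangent p :=
  fun a => oapp v x (unlift ord0 a).

Definition interior_product k (X : vfield) (w : kfield k.+1) : kfield k :=
  fun p v => w p (vcons (X p) v).

Definition wedge k l (w : kfield k) (t : kfield l) : kfield (k + l) :=
  fun p v => (k`! * l`!)%:R^-1 *
    \sum_(s : 'S_(k + l)) (-1) ^+ s
      * w p (fun a => v (s (lshift l a))) * t p (fun b => v (s (rshift k b))).

Fixpoint wedge_pow k (w : kfield k) (n : nat) : kfield (n * k) :=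
  match n return kfield (n * k) with
  | 0 => fun_form (fun=> 1)
  | n'.+1 => wedge w (@wedge_pow k w n')
  end.

#[global] Arguments fun_form h p v : clear implicits.
#[global] Arguments interior_product [k] X w p v.
#[global] Arguments wedge [k l] w t p v.
#[global] Arguments wedge_pow [k] w n p v.

Definition nowhere_zero k (w : kfield k) : Prop :=
  forall p, exists v : 'I_k -> tangent p, w p v != 0.

(* (dw)(v_0, .., v_k) = \sum_a (-1)^a v_a (w(v_0, .., ^v_a, .., v_k)), where the
   vectors are extended with constant components in the chart [chart_at p] (the
   brackets of these extensions vanish; the value is the same in any chart). *)
Definition extd k (w : kfield k) : kfield k.+1 :=
  fun p v => let i := chart_at p in
    \sum_(a < k.+1) (-1) ^+ a *
      'D_(v a i) (fun x => kfield_in i w x (fun b => v (lift a b) i))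
        (chart_map i p).

(* (L_X w)(Y_1, .., Y_k) = X (w(Y_1, .., Y_k)) - \sum_a w(Y_1, .., [X, Y_a], ..)
   for the extensions Y_a of the v_a with constant components in [chart_at p],
   for which [X, Y_a] = - D_{v_a} X; the value is the same in any chart. *)
Definition lie k (X : vfield) (w : kfield k) : kfield k :=
  fun p v => let i := chart_at p in
    'D_(X p i) (fun x => kfield_in i w x (fun a => v a i)) (chart_map i p)
    + \sum_(a < k) w p [eta v with
        a |-> tvec i p ('D_(v a i) (vfield_in i X) (chart_map i p))].

#[global] Arguments extd [k] w p v.
#[global] Arguments lie [k] X w p v.

(* Covectors at p are the functions [tangent p -> R] which satisfy [scalar]. *)
Definition covector (w : kfield 1) (p : M) : tangent p -> R :=
  fun x => w p (fun=> x).

#[global] Arguments covector w p x : clear implicits.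

Definition dcoord (i : chart M) (p : M) (j : 'I_m) : tangent p -> R :=
  fun x => x i ord0 j.

Definition bfield := forall p : M, (tangent p -> R) -> (tangent p -> R) -> R.

Definition is_bivector (L : bfield) : Prop :=
  [/\ forall p (c : R) (a b e : tangent p -> R),
        scalar a -> scalar b -> scalar e ->
        L p (c *: a + b) e = c * L p a e + L p b e,
      forall p (a b : tangent p -> R),
        scalar a -> scalar b -> L p a b = - L p b a &
      forall i j k, smooth_on (chart_img i)
        (fun x => let p := chart_inv i x in L p (dcoord i j) (dcoord i k))].

Definition flat (W : kfield 2) (p : M) (y : tangent p) : tangent p -> R :=
  fun x => W p (vcons y (fun=> x)).

(* The vector u with b(u) = L(a, b) for all covectors b. *)
Definition sharp (L : bfield) (p : M) (a : tangent p -> R) : tangent p :=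
  xget 0 [set u : tangent p |
    forall b : tangent p -> R, scalar b -> b u = L p a b].

Lemma sharpP (L : bfield) (p : M) (a b : tangent p -> R) :
  is_bivector L -> scalar a -> scalar b -> b (sharp L a) = L p a b.
Proof.
move=> [Ll La _] sa sb.
have Lr c x y : scalar x -> scalar y -> scalar (c *: x + y) ->
   L p a (c *: x + y) = c * L p a x + L p a y.
  move=> sx sy sxy.
  by rewrite La// Ll// La// (La _ y)// mulrN opprD !opprK.
pose i := chart_at p; have ip : chart_dom i p := chart_atP p.
have scal_dc j : scalar (dcoord i (p := p) j).
  move=> c x y; rewrite /dcoord.
  have -> : (c *: x + y : tangent p) i = c *: x i + y i by [].
  by rewrite !mxE.
have comb (s : seq 'I_m) (f : 'I_m -> R) :
    scalar (\sum_(j <- s) f j *: dcoord i (p := p) j) /\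
    L p a (\sum_(j <- s) f j *: dcoord i (p := p) j) =
    \sum_(j <- s) f j * L p a (dcoord i j).
  elim: s => [|j s [IHs IHL]].
    rewrite !big_nil; split; first by move=> c x y; rewrite mulr0 addr0.
    have s0 : scalar (0 : tangent p -> R).
      by move=> c x y; rewrite mulr0 addr0.
    have := Lr (-1) 0 0 s0 s0; rewrite scaler0 addr0 => /(_ s0).
    by rewrite mulN1r addNr.
  have sc : scalar (f j *: dcoord i (p := p) j + \sum_(j <- s) f j *: dcoord i (p := p) j).
    move=> c x y.
    rewrite -[LHS]/(f j * dcoord i j (c *: x + y) + (\sum_(j <- s) f j *: dcoord i (p:=p) j) (c *: x + y)).
    rewrite scal_dc IHs -[(_ + _ : tangent p -> R) x]/(f j * dcoord i j x + (\sum_(j <- s) f j *: dcoord i (p:=p) j) x)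
      -[(_ + _ : tangent p -> R) y]/(f j * dcoord i j y + (\sum_(j <- s) f j *: dcoord i (p:=p) j) y).
    by rewrite !mulrDr !mulrA [f j * c]mulrC addrACA.
  by rewrite !big_cons; split=> //; rewrite Lr// IHL.
pose u : tangent p := tvec i p (\row_j L p a (dcoord i j)).
have uP b' : scalar b' -> b' u = L p a b'.
  move=> sb'.
  have eb : b' = \sum_j b' (tvec i p (delta_mx ord0 j)) *: dcoord i (p:=p) j.
    apply/funext => v; rewrite fct_sumE (scalar_expand v ip sb').
    by apply: eq_bigr => j _; rewrite mulrC.
  rewrite [in RHS]eb (comb _ _).2 (scalar_expand u ip sb').
  by apply: eq_bigr => j _; rewrite /u tvecK// mxE mulrC.
rewrite /sharp; case: xgetP => [v _ /(_ _ sb)//|/(_ u)]; tauto.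
Qed.
Definition sharp_field (L : bfield) (a : kfield 1) : vfield :=
  fun p => sharp L (covector a p).

Definition regular_acc (n : nat) (w : kfield 1) (W : kfield 2) : Prop :=
  [/\ is_form w, is_form W,
      forall p v, extd W p v = 0 &
      nowhere_zero (wedge w (wedge_pow W n))].

Definition dual_pair (w : kfield 1) (W : kfield 2) (E : vfield) (L : bfield) :
    Prop :=
  [/\ smooth_vfield E, is_bivector L,
      (forall p : M,
        (forall u, [set sharp L a | a in [set a : tangent p -> R | scalar a]] u ->
           sharp L (flat W u) = u) /\
        (forall a, [set flat W u | u in [set: tangent p]] a ->
           flat W (sharp L a) = a)) &
      [/\ forall p v, interior_product E w p v = 1,
          forall p v, interior_product E W p v = 0 &
          forall p (b : tangent p -> R),
            scalar b -> L p (covector w p) b = 0]].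

Definition Xfield (E : vfield) (L : bfield) (a : kfield 1) (h : M -> R) :
    vfield :=
  fun p => sharp_field L a p + h p *: E p.

End Calculus.

(* Main.v *)
Require Import Defs.
From mathcomp Require Import all_boot all_order all_algebra.
From mathcomp Require Import all_fingroup.
From mathcomp Require Import all_classical all_reals all_analysis.

Set Implicit Arguments.
Unset Strict Implicit.
Unset Printing Implicit Defensive.

Import Order.TTheory GRing.Theory Num.Theory.
Import numFieldNormedType.Exports.

Local Open Scope classical_set_scope.
Local Open Scope ring_scope.

(** The statement is Cartan's formula read through the dual pair.

    If X = alpha^sharp + h E, then omega(X) = h, because
    omega(alpha^sharp) = Lambda(alpha, omega) = 0 and omega(E) = 1
    ([omega_Xfield]).  Cartan's formula L_X omega = i_X d omega + d(omega(X))
    ([cartan_formula]) and the linearity of i_X d omega in X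
    ([extd1_linear]) then turn L_X omega into the left-hand side of the
    equation for (alpha, h).  So the equivalence holds as soon as every smooth X
    is some X_(alpha, h).

    That decomposition is X = (i_X Omega)^sharp + omega(X) E
    ([dual_pair_decomposition]).  The difference of the two sides is killed by
    omega and by Omega^flat: for the latter, the dual pair makes sharp a right
    inverse of flat on the image of flat.  A vector in both kernels is zero
    because omega /\ Omega^n is a nonzero top-degree form
    ([regular_acc_kernel]): a vector y killed by omega and Omega kills the
    whole wedge product, while a family of vectors on which a top-degree
    alternating form is nonzero is a basis, and replacing its a-th vector
    by y multiplies the value of the form by the a-th coordinate of y, so all
    coordinates of y vanish ([top_form_nondegenerate]).

    Finally i_X Omega is a smooth 1-form and omega(X) a smooth function, since
    in a chart both are sums of products of smooth components of X and of the
    form ([is_form_interior_product]). *)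

(** * Smooth maps on an open set *)

(** Differentiability is a first-order expansion at x, and expansions only see
    germs: g has the expansion of f, with the same differential. *)
Lemma near_eq_differentiable (R : numFieldType) (V W : normedModType R)
    (f g : V -> W) (x : V) :
  (\forall y \near x, f y = g y) -> differentiable f x -> differentiable g x.
Proof.
move=> fg /diff_locallyP[dc df].
have dg : g \o shift x = cst (g x) + 'd f x +o_ (0 : V) id.
  apply/eqaddoP => e e0; move/eqaddoP: df => /(_ e e0) df.
  have fg0 : \forall h \near (0 : V), f (h + x) = g (h + x).
    by move: fg; rewrite (near_shift 0) /= subr0.
  near=> h.
  have -> : (g \o shift x - (cst (g x) + 'd f x)) h =
            (f \o shift x - (cst (f x) + 'd f x)) h.
    rewrite !fctE -(nbhs_singleton fg); congr (_ - _).
    by apply: esym; near: h.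
  by near: h.
by apply/diff_locallyP; rewrite (diff_unique dc dg).
Unshelve. all: by end_near. Qed.

(** Openness of U is what makes the directional derivatives agree on U again,
    so that the induction on k goes through.  The closure properties below rest
    on this lemma: the rules for the derivative of a sum or a product hold only
    at the points of U, where the maps are differentiable. *)
Lemma Ck_on_eq (R : realType) (V W : normedModType R) k (U : set V)
    (f g : V -> W) :
  open U -> (forall x, U x -> f x = g x) -> Ck_on k U f -> Ck_on k U g.
Proof.
move=> oU; elim: k f g => [|k IH] f g fg.
  move=> cf x Ux.
  suff : g y @[y --> x] --> f x by rewrite (fg x Ux).
  apply: cvg_trans (cf x Ux); apply: near_eq_cvg.
  by apply: filterS (open_nbhs_nbhs (conj oU Ux)) => y /fg.
have nfg x : U x -> \forall y \near x, f y = g y.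
  by move=> Ux; apply: filterS (open_nbhs_nbhs (conj oU Ux)) => y /fg.
move=> [df cf]; split=> [x Ux|v].
  exact: near_eq_differentiable (nfg x Ux) (df x Ux).
by apply: (IH _ _ _ (cf v)) => x Ux; exact: near_eq_derive (nfg x Ux).
Qed.

Lemma smooth_on_eq (R : realType) (V W : normedModType R) (U : set V)
    (f g : V -> W) :
  open U -> (forall x, U x -> f x = g x) -> smooth_on U f -> smooth_on U g.
Proof. by move=> oU fg sf k; exact: Ck_on_eq (sf k). Qed.

Lemma Ck_on_pred (R : realType) (V W : normedModType R) k (U : set V)
    (f : V -> W) : Ck_on k.+1 U f -> Ck_on k U f.
Proof.
elim: k f => [|k IH] f [df cf].
  by move=> x Ux; exact: differentiable_continuous (df x Ux).
by split=> // v; exact: IH.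
Qed.

Lemma smooth_on_differentiable (R : realType) (V W : normedModType R)
    (U : set V) (f : V -> W) x :
  smooth_on U f -> U x -> differentiable f x.
Proof. by move=> /(_ 1)[df _]; exact: df. Qed.

Lemma Ck_on_cst (R : realType) (V W : normedModType R) k (U : set V) (a : W) :
  Ck_on k U (fun=> a : W).
Proof.
elim: k a => [|k IH] a; first by move=> x _; exact: cvg_cst.
split=> [x _|v]; first exact: differentiable_cst.
have -> : 'D_v (fun=> a) = (fun=> 0) :> (V -> W).
  by apply/funext => x; rewrite derive_cst.
exact: IH.
Qed.

Lemma Ck_onD (R : realType) (V W : normedModType R) k (U : set V)
    (f g : V -> W) :
  open U -> Ck_on k U f -> Ck_on k U g -> Ck_on k U (f + g).
Proof.
move=> oU; elim: k f g => [|k IH] f g.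
  by move=> cf cg x Ux; apply: cvgD; [exact: cf|exact: cg].
move=> [df cf] [dg cg]; split=> [x Ux|v].
  by apply: differentiableD; [exact: df|exact: dg].
apply: (Ck_on_eq oU _ (IH _ _ (cf v) (cg v))) => x Ux.
by rewrite deriveD//; apply: diff_derivable; [exact: df|exact: dg].
Qed.

(** The derivative of f * g involves f and g themselves, which are only known to
    be one order smoother than the induction hypothesis asks for. *)
Lemma Ck_onM (R : realType) (V : normedModType R) k (U : set V)
    (f g : V -> R) :
  open U -> Ck_on k U f -> Ck_on k U g -> Ck_on k U (f * g).
Proof.
move=> oU; elim: k f g => [|k IH] f g.
  by move=> cf cg x Ux; apply: cvgM; [exact: cf|exact: cg].
move=> cf' cg'; have [df cf] := cf'; have [dg cg] := cg'.
split=> [x Ux|v].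
  by apply: differentiableM; [exact: df|exact: dg].
have := Ck_onD oU (IH _ _ (Ck_on_pred cf') (cg v)) (IH _ _ (Ck_on_pred cg') (cf v)).
apply: Ck_on_eq => // x Ux.
by rewrite deriveM//; apply: diff_derivable; [exact: df|exact: dg].
Qed.

Lemma smooth_onM (R : realType) (V : normedModType R) (U : set V)
    (f g : V -> R) :
  open U -> smooth_on U f -> smooth_on U g -> smooth_on U (f * g).
Proof. by move=> oU sf sg k; exact: Ck_onM. Qed.

Lemma smooth_on_sum (R : realType) (V W : normedModType R) (U : set V)
    (n : nat) (f : 'I_n -> V -> W) :
  open U -> (forall i, smooth_on U (f i)) -> smooth_on U (\sum_i f i).
Proof.
move=> oU sf k; elim/big_ind: _ => [|g h|i _]; [exact: Ck_on_cst|exact: Ck_onD|].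
exact: sf.
Qed.

Lemma derive_coord (R : realType) (V : normedModType R) (m : nat)
    (f : V -> 'rV[R]_m) (x v : V) (j : 'I_m) :
  differentiable f x ->
  'D_v (fun y => f y ord0 j) x = ('D_v f x) ord0 j.
Proof. by move=> df; rewrite derive_mx ?mxE//; exact: diff_derivable. Qed.

Lemma differentiable_rowcoord (R : realType) (V : normedModType R) (m : nat)
    (f : V -> 'rV[R]_m) (x : V) (j : 'I_m) :
  differentiable f x -> differentiable (fun y => f y ord0 j) x.
Proof.
move=> df; apply: (differentiable_comp (g := fun N : 'rV_m => N ord0 j)) => //.
exact: differentiable_coord.
Qed.

Lemma smooth_on_coord (R : realType) (V : normedModType R) (m : nat)
    (U : set V) (f : V -> 'rV[R]_m) (j : 'I_m) :
  open U -> smooth_on U f -> smooth_on U (fun x => f x ord0 j).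
Proof.
move=> oU sf k; move: {sf}(sf k); elim: k f => [|k IH] f.
  move=> cf x Ux; apply: (@continuous_comp _ _ _ f (fun N => N ord0 j)).
    exact: cf.
  exact: coord_continuous.
move=> [df cf]; split=> [x Ux|v]; first exact/differentiable_rowcoord/df.
by apply: (Ck_on_eq oU _ (IH _ (cf v))) => x Ux; rewrite derive_coord//; exact: df.
Qed.

(** * Alternating forms on a vector space *)

Definition multilinear (R : realType) (V : lmodType R) k
    (f : ('I_k -> V) -> R) : Prop :=
  forall (v : 'I_k -> V) a (c : R) (x y : V),
    f [eta v with a |-> c *: x + y]
    = c * f [eta v with a |-> x] + f [eta v with a |-> y].

Definition alternating (R : realType) (V : lmodType R) k
    (f : ('I_k -> V) -> R) : Prop :=
  forall (v : 'I_k -> V) a b, a != b -> v a = v b -> f v = 0.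

(** For multilinear f this says that the contraction of f with y in any slot is
    zero; it is stated for all slots so that it passes to wedge products, whose
    terms permute the arguments. *)
Definition vanishes_on (R : realType) (V : lmodType R) k
    (f : ('I_k -> V) -> R) (y : V) : Prop :=
  forall (v : 'I_k -> V) a, v a = y -> f v = 0.

Section Multilinear.
Context {R : realType} {V : lmodType R}.

Lemma with_same k (v : 'I_k -> V) a : [eta v with a |-> v a] = v :> ('I_k -> V).
Proof. by apply/funext => b /=; case: eqVneq => // ->. Qed.

Lemma with_at k (v : 'I_k -> V) a x : [eta v with a |-> x] a = x.
Proof. by rewrite /= eqxx. Qed.

Lemma with_out k (v : 'I_k -> V) a b x : b != a -> [eta v with a |-> x] b = v b.
Proof. by move=> /negbTE /= ->. Qed.

Lemma multilinear_sum k (f : ('I_k -> V) -> R) (v : 'I_k -> V) a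
    (n : nat) (c : 'I_n -> R) (x : 'I_n -> V) :
  multilinear f ->
  f [eta v with a |-> \sum_j c j *: x j] =
  \sum_j c j * f [eta v with a |-> x j].
Proof.
move=> fl.
have f0 : f [eta v with a |-> 0] = 0.
  by have := fl v a (-1) 0 0; rewrite scaler0 addr0 mulN1r addNr.
elim/big_rec2: _ => [//|j s t _ IH]; by rewrite fl IH.
Qed.

(** This is Cramer's rule: the terms with b != a repeat v b. *)
Lemma alternating_comb k (f : ('I_k -> V) -> R) (v : 'I_k -> V) a
    (c : 'I_k -> R) :
  multilinear f -> alternating f ->
  f [eta v with a |-> \sum_b c b *: v b] = c a * f v.
Proof.
move=> fl fa; rewrite multilinear_sum// (bigD1 a)//= with_same big1 ?addr0//.
move=> b ba; rewrite (fa _ a b) ?mulr0//=; first by rewrite eq_sym.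
by rewrite eqxx (negbTE ba).
Qed.

(** Polarization of f(.., z, .., z, ..) = 0 moves y from slot a to slot 0. *)
Lemma vanishes_on_head k (f : ('I_k.+1 -> V) -> R) (y : V) :
  multilinear f -> alternating f -> (forall v, v ord0 = y -> f v = 0) ->
  vanishes_on f y.
Proof.
move=> fl fa f0 v a va; have [a0|a0] := eqVneq a ord0; first by apply: f0; rewrite -a0.
(* g is f as a function of slots 0 and a only *)
pose g z t := f [eta [eta v with ord0 |-> z] with a |-> t].
have gr z s t : g z (s + t) = g z s + g z t.
  by have := fl [eta v with ord0 |-> z] a 1 s t; rewrite scale1r mul1r.
have gE z t : g z t = f [eta [eta v with a |-> t] with ord0 |-> z].
  congr f; apply/funext => b /=.
  by case: (eqVneq b a) => // ->; rewrite (negbTE a0).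
have gl z s t : g (z + s) t = g z t + g s t.
  by rewrite !gE; have := fl [eta v with a |-> t] ord0 1 z s; rewrite scale1r mul1r.
have gyt t : g y t = 0 by rewrite gE; apply: f0; rewrite with_at.
have gdiag z : g z z = 0.
  by apply: (fa _ a ord0) => //; rewrite with_at with_out 1?eq_sym// with_at.
have -> : f v = g (v ord0) y.
  by rewrite -va /g with_same; congr f; rewrite with_same.
have := gdiag (v ord0 + y).
by rewrite gl !gr gdiag !gyt !addr0 add0r.
Qed.

End Multilinear.

(** * Wedge products and top-degree forms *)

Section Forms.
Context {R : realType} {m : nat} {M : smooth_manifold R m}.

(** In the term of the permutation s, slot a of the product is slot s^-1 a of
    exactly one of the two factors. *)
Lemma multilinear_wedge k l (w : kfield M k) (t : kfield M l) (p : M) :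
  multilinear (w p) -> multilinear (t p) -> multilinear (wedge w t p).
Proof.
move=> wl tl v a c x y; rewrite /wedge mulrCA -mulrDr; congr (_ * _).
rewrite mulr_sumr -big_split; apply: eq_bigr => s _ /=.
pose a' := (s^-1)%g a; have sa : s a' = a by rewrite permKV.
have [b e|b e] := split_ordP a'; rewrite {}e in sa.
- have updl z : (fun b' => if s (lshift l b') == a then z else v (s (lshift l b')))
      = [eta (fun b' => v (s (lshift l b'))) with b |-> z].
    by apply/funext => b' /=; rewrite -sa (inj_eq perm_inj) (inj_eq (@lshift_inj _ _)).
  have updr z : (fun b' => if s (rshift k b') == a then z else v (s (rshift k b')))
      = (fun b' => v (s (rshift k b'))).
    by apply/funext => b'; rewrite -sa (inj_eq perm_inj) eq_rlshift.
  by rewrite !updl !updr wl mulrDr mulrDl !mulrA (mulrC c).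
- have updl z : (fun b' => if s (lshift l b') == a then z else v (s (lshift l b')))
      = (fun b' => v (s (lshift l b'))).
    by apply/funext => b'; rewrite -sa (inj_eq perm_inj) eq_lrshift.
  have updr z : (fun b' => if s (rshift k b') == a then z else v (s (rshift k b')))
      = [eta (fun b' => v (s (rshift k b'))) with b |-> z].
    by apply/funext => b' /=; rewrite -sa (inj_eq perm_inj) (inj_eq (@rshift_inj _ _)).
  by rewrite !updl !updr tl mulrDr mulrCA.
Qed.

(** If v a = v b, composing s with the transposition of a and b keeps the
    vectors of the term and flips its sign, so the sum is its own opposite. *)
Lemma alternating_wedge k l (w : kfield M k) (t : kfield M l) (p : M) :
  alternating (wedge w t p).
Proof.
move=> v a b ab vab; rewrite /wedge; set S := \sum_s _.
suff : S = - S.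
  by move/eqP; rewrite -addr_eq0 -mulr2n mulrn_eq0/= => /eqP ->; rewrite mulr0.
rewrite {1}/S (reindex_inj (mulIg (tperm a b))) /= -sumrN.
apply: eq_bigr => s _.
have vs c : v ((s * tperm a b)%g c) = v (s c).
  by rewrite permM; case: tpermP => [->|->|].
rewrite odd_permM odd_tperm ab addbT signrN !mulNr.
by congr (- (_ * w p _ * t p _)); apply/funext => c; rewrite vs.
Qed.

Lemma vanishes_on_wedge k l (w : kfield M k) (t : kfield M l) (p : M)
    (y : tangent p) :
  vanishes_on (w p) y -> vanishes_on (t p) y -> vanishes_on (wedge w t p) y.
Proof.
move=> w0 t0 v a va; rewrite /wedge big1 ?mulr0// => s _.
pose a' := (s^-1)%g a; have sa : s a' = a by rewrite permKV.
have [b e|b e] := split_ordP a'; rewrite {}e in sa.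
- by rewrite (w0 _ b) ?sa// mulr0 mul0r.
- by rewrite (t0 _ b) ?sa// mulr0.
Qed.

Lemma multilinear_wedge_pow k (w : kfield M k) n (p : M) :
  multilinear (w p) -> multilinear (wedge_pow w n p).
Proof.
move=> wl; elim: n => [|n IH]; first by move=> v [].
exact: multilinear_wedge.
Qed.

Lemma vanishes_on_wedge_pow k (w : kfield M k) n (p : M) (y : tangent p) :
  vanishes_on (w p) y -> vanishes_on (wedge_pow w n p) y.
Proof.
move=> wl; elim: n => [|n IH]; first by move=> v [].
exact: vanishes_on_wedge.
Qed.

Lemma componentD (p : M) i (u v : tangent p) : (u + v) i = u i + v i.
Proof. by []. Qed.

Lemma componentZ (p : M) i c (u : tangent p) : (c *: u) i = c *: u i.
Proof. by []. Qed.

Lemma component_sum (p : M) i n (x : 'I_n -> tangent p) :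
  (\sum_j x j) i = \sum_j x j i.
Proof. by apply: (big_morph (fun v : tangent p => v i)). Qed.

(** By [alternating_comb], the coefficient of v a in a combination of the v b can
    be read off by substituting the combination for v a in f v.  Applied to
    a vanishing combination, this shows that the m vectors v b are a basis;
    applied to y, it shows that the coordinates of y in this basis vanish. *)
Lemma top_form_nondegenerate (p : M) (f : ('I_m -> tangent p) -> R)
    (y : tangent p) v :
  multilinear f -> alternating f -> f v != 0 -> vanishes_on f y -> y = 0.
Proof.
move=> fl fa fv fy; pose i := chart_at p; have ip : chart_dom i p := chart_atP p.
pose A := \matrix_a v a i.
have comb (c : 'rV_m) : (\sum_a c ord0 a *: v a) i = c *m A.
  rewrite component_sum mulmx_sum_row; apply: eq_bigr => a _.
  by rewrite componentZ rowK.
have Au : A \in unitmx.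
  rewrite -row_free_unit; apply: inj_row_free => c cA; apply/rowP => a.
  have c0 : \sum_b c ord0 b *: v b = 0.
    by apply: (tangent_inj ip); rewrite comb cA.
  apply/eqP; rewrite mxE -(mulIr_eq0 _ (mulIf fv)).
  rewrite -alternating_comb// c0; apply/eqP.
  by have := fl v a (-1) 0 0; rewrite scaler0 addr0 mulN1r addNr.
pose c := y i *m invmx A.
have yE : y = \sum_b c ord0 b *: v b.
  by apply: (tangent_inj ip); rewrite comb mulmxKV.
apply: (tangent_inj ip); rewrite yE comb.
suff -> : c = 0 by rewrite mul0mx.
apply/rowP => a; rewrite [RHS]mxE; apply/eqP; rewrite -(mulIr_eq0 _ (mulIf fv)).
by rewrite -alternating_comb// -yE (fy _ a)//= eqxx.
Qed.

End Forms.

(** * Contraction of forms with vector fields *)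

Section Contraction.
Context {R : realType} {m : nat} {M : smooth_manifold R m}.

Lemma vcons0 (p : M) k (x : tangent p) (v : 'I_k -> tangent p) :
  vcons x v ord0 = x.
Proof. by rewrite /vcons unlift_none. Qed.

Lemma vconsS (p : M) k (x : tangent p) (v : 'I_k -> tangent p) a :
  vcons x v (lift ord0 a) = v a.
Proof. by rewrite /vcons liftK. Qed.

Lemma vcons_with0 (p : M) k (x y : tangent p) (v : 'I_k -> tangent p) :
  vcons x v = [eta vcons y v with ord0 |-> x] :> ('I_k.+1 -> tangent p).
Proof.
apply/funext => a; have [b ->|->] := unliftP ord0 a.
  by rewrite with_out ?vconsS// neq_lift.
by rewrite with_at vcons0.
Qed.

Lemma vcons_with (p : M) k (x y : tangent p) (v : 'I_k -> tangent p) a :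
  vcons x [eta v with a |-> y] = [eta vcons x v with lift ord0 a |-> y]
  :> ('I_k.+1 -> tangent p).
Proof.
apply/funext => b; have [c ->|->] := unliftP ord0 b.
  by rewrite vconsS /= (inj_eq lift_inj); case: eqP => // _; rewrite vconsS.
by rewrite with_out ?vcons0// neq_lift.
Qed.

Lemma vcons_decomp (p : M) k (v : 'I_k.+1 -> tangent p) :
  v = vcons (v ord0) (fun a => v (lift ord0 a)).
Proof.
by apply/funext => a; have [b ->|->] := unliftP ord0 a; rewrite ?vconsS ?vcons0.
Qed.

Lemma is_form_vcons_expand k (w : kfield M k.+1) i (p : M) (x : tangent p)
    (v : 'I_k -> tangent p) :
  multilinear (w p) -> chart_dom i p ->
  w p (vcons x v) =
  \sum_j x i ord0 j * w p (vcons (tvec i p (delta_mx ord0 j)) v).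
Proof.
move=> wl ip; rewrite (vcons_with0 x 0) {1}(tangent_expand x ip) multilinear_sum//.
by apply: eq_bigr => j _; rewrite -vcons_with0.
Qed.

Lemma smooth_fun_form (h : M -> R) : is_form (fun_form h) -> smooth_fun h.
Proof. by move=> [_ _ sh] i; apply: sh => -[]. Qed.

Lemma chart_img_dom i (x : 'rV[R]_m) :
  chart_img (M := M) i x -> chart_dom i (chart_inv i x).
Proof. by move=> [q iq <-]; rewrite chart_mapK. Qed.

(** In a chart, i_X w is the sum over j of X^j times the contraction of w with
    the j-th coordinate field. *)
Lemma is_form_interior_product k (X : vfield M) (w : kfield M k.+1) :
  smooth_vfield X -> is_form w -> is_form (interior_product X w).
Proof.
move=> sX [wl wa ws]; split=> [p v a c x y|p v a b ab vab|i v].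
- by rewrite /interior_product !vcons_with wl.
- apply: (wa p _ (lift ord0 a) (lift ord0 b)); last by rewrite !vconsS.
  by rewrite (inj_eq lift_inj).
have oU : open (chart_img (M := M) i) by exact: chart_img_open.
pose u j a := oapp v (delta_mx ord0 j : 'rV[R]_m) (unlift ord0 a).
apply: (@smooth_on_eq _ _ _ _
  (\sum_j ((fun x => vfield_in i X x ord0 j) * (fun x => kfield_in i w x (u j))))).
- exact: oU.
- move=> x /chart_img_dom ix; rewrite fct_sumE /kfield_in /interior_product.
  rewrite (is_form_vcons_expand _ _ (wl _) ix); apply: eq_bigr => j _.
  rewrite !fctE; congr (_ * w _ _); apply/funext => a.
  by rewrite /u /vcons; case: unliftP.
- apply: smooth_on_sum => // j; apply: smooth_onM => //.
  exact: smooth_on_coord.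
Qed.

Lemma covector_scalar (w : kfield M 1) p : multilinear (w p) -> scalar (covector w p).
Proof.
move=> wl c x y; have := wl (fun=> 0) ord0 c x y.
have e z : [eta (fun=> 0) with ord0 |-> z] = (fun=> z) :> ('I_1 -> tangent p).
  by apply/funext => a; rewrite (ord1 a) with_at.
by rewrite !e.
Qed.

Lemma flat_scalar (W : kfield M 2) p (y : tangent p) :
  multilinear (W p) -> scalar (flat W y).
Proof.
move=> Wl c u v; have e z : vcons y (fun=> z) =
    [eta vcons y (fun=> 0) with lift ord0 ord0 |-> z] :> ('I_2 -> tangent p).
  rewrite -vcons_with; congr vcons; apply/funext => a.
  by rewrite (ord1 a) with_at.
by rewrite /flat (e (_ *: _ + _)) (e u) (e v) Wl.
Qed.

Lemma flat_linear (W : kfield M 2) p (c : R) (y z : tangent p) :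
  multilinear (W p) -> flat W (c *: y + z) = c *: flat W y + flat W z.
Proof.
move=> Wl; apply/funext => t; rewrite /flat (vcons_with0 (c *: y + z) 0) Wl.
by rewrite -!vcons_with0.
Qed.

Lemma tvec_linear i (p : M) : chart_dom i p -> linear (tvec i p).
Proof.
move=> ip c u v; apply: (tangent_inj ip).
by rewrite componentD componentZ !tvecK.
Qed.

(** * Cartan's formula for 1-forms *)

(** This is the Leibniz rule for the pairing omega(X) = sum_j X^j omega_j, split
    into the part which differentiates the omega_j, with the components of X
    frozen at p, and the part which differentiates the X^j. *)
Lemma derive_contraction (w : kfield M 1) (X : vfield M) i (p : M)
    (z : 'rV[R]_m) :
  is_form w -> smooth_vfield X -> chart_dom i p ->
  'D_z (fun x => covector w (chart_inv i x) (X (chart_inv i x))) (chart_map i p) =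
  'D_z (fun x => kfield_in i w x (fun=> X p i)) (chart_map i p)
  + covector w p (tvec i p ('D_z (vfield_in i X) (chart_map i p))).
Proof.
move=> [wl wa ws] sX ip; set x0 := chart_map i p.
have px0 : chart_img i x0 by exists p.
pose e j : 'rV[R]_m := delta_mx ord0 j.
pose a j x := kfield_in i w x (fun=> e j).
have da j : differentiable (a j) x0.
  exact: smooth_on_differentiable (ws i (fun=> e j)) px0.
have dX : differentiable (vfield_in i X) x0.
  exact: smooth_on_differentiable (sX i) px0.
have near_img : \forall x \near x0, chart_img (M := M) i x.
  by apply: filterS (chart_img_nbhs ip ip) => x [].
have cov q (u : tangent q) : chart_dom i q ->
    covector w q u = \sum_j u i ord0 j * covector w q (tvec i q (e j)).
  by move=> iq; apply: scalar_expand => //; exact: covector_scalar.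
have -> : 'D_z (fun x => covector w (chart_inv i x) (X (chart_inv i x))) x0 =
    'D_z (\sum_j (fun x => vfield_in i X x ord0 j) * a j) x0.
  apply: near_eq_derive; apply: filterS near_img => x /chart_img_dom ix.
  by rewrite cov// fct_sumE.
have -> : 'D_z (fun x => kfield_in i w x (fun=> X p i)) x0 =
    'D_z (\sum_j X p i ord0 j *: a j) x0.
  apply: near_eq_derive; apply: filterS near_img => x /chart_img_dom ix.
  rewrite -[LHS]/(covector w _ (tvec i _ (X p i))) cov// fct_sumE.
  by apply: eq_bigr => j _; rewrite tvecK.
have dXj j : differentiable (fun x => vfield_in i X x ord0 j) x0.
  exact: differentiable_rowcoord.
rewrite !derive_sum; last first.
- by move=> j; apply/diff_derivable/differentiableM.
- by move=> j; apply/diff_derivable/differentiableZ.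
rewrite cov// -big_split; apply: eq_bigr => j _ /=.
rewrite deriveM; [|exact: diff_derivable..].
rewrite deriveZ; last exact: diff_derivable.
rewrite tvecK// derive_coord// /vfield_in /a /kfield_in /x0.
by rewrite chart_mapK// [X in _ + X]mulrC.
Qed.

Lemma extd1E (w : kfield M 1) (p : M) (u : tangent p) (v : 'I_1 -> tangent p) :
  let i := chart_at p in
  extd w p (vcons u v) =
  'D_(u i) (fun x => kfield_in i w x (fun=> v ord0 i)) (chart_map i p) -
  'D_(v ord0 i) (fun x => kfield_in i w x (fun=> u i)) (chart_map i p).
Proof.
move=> i; rewrite /extd big_ord_recl big_ord1 expr0 mul1r expr1 mulN1r vcons0 vconsS.
congr (_ - _); congr derive; apply/funext => x; congr kfield_in; apply/funext => b.
  by rewrite (ord1 b) vconsS.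
by rewrite (ord1 b) [lift _ _](_ : _ = ord0) ?vcons0//; apply: val_inj.
Qed.

Lemma extd_fun_form (h : M -> R) (p : M) (v : 'I_1 -> tangent p) :
  let i := chart_at p in
  extd (fun_form h) p v = 'D_(v ord0 i) (fun x => h (chart_inv i x)) (chart_map i p).
Proof. by move=> i; rewrite /extd big_ord1 expr0 mul1r. Qed.

(** In the chart at p, d(w(X)) is the sum of the derivative of w along v applied
    to the frozen X and of w applied to the derivative of X; the first cancels
    the second term of i_X dw, and the second is the bracket term of L_X w. *)
Lemma cartan_formula (w : kfield M 1) (X : vfield M) (p : M)
    (v : 'I_1 -> tangent p) :
  is_form w -> smooth_vfield X ->
  lie X w p v = interior_product X (extd w) p v
                + extd (fun_form (fun q => covector w q (X q))) p v.
Proof.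
move=> wf sX; rewrite /interior_product extd1E extd_fun_form.
set i := chart_at p; have ip : chart_dom i p := chart_atP p.
rewrite derive_contraction// addrA subrK /lie big_ord1; congr (_ + w p _).
  congr derive.
  by apply/funext => x; congr kfield_in; apply/funext => a; rewrite (ord1 a).
by apply/funext => a; rewrite (ord1 a) with_at.
Qed.

(** In [extd1E] the vector u is both a direction of derivation, where linearity
    comes from differentiability of the components of w, and an argument of w
    under a derivative, where it comes from the linearity of w. *)
Lemma extd1_linear (w : kfield M 1) (p : M) (v : 'I_1 -> tangent p) :
  is_form w -> scalar (fun u => extd w p (vcons u v)).
Proof.
move=> wf c u u'; rewrite !extd1E.
set i := chart_at p; have ip : chart_dom i p := chart_atP p.
set x0 := chart_map i p; have px0 : chart_img i x0 by exists p.
have [wl _ ws] := wf.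
have dw z : differentiable (fun x => kfield_in i w x (fun=> z)) x0.
  exact: smooth_on_differentiable (ws i (fun=> z)) px0.
have -> : 'D_(v ord0 i) (fun x => kfield_in i w x (fun=> (c *: u + u') i)) x0 =
  'D_(v ord0 i) (c *: (fun x => kfield_in i w x (fun=> u i)) +
                 (fun x => kfield_in i w x (fun=> u' i))) x0.
  apply: near_eq_derive.
  apply: filterS (chart_img_nbhs ip ip) => x -[_ ix].
  have := covector_scalar (wl (chart_inv i x)) c (tvec i _ (u i)) (tvec i _ (u' i)).
  by rewrite -tvec_linear.
rewrite deriveD; [|exact/diff_derivable/differentiableZ|exact: diff_derivable].
rewrite deriveZ; last exact: diff_derivable.
rewrite (deriveE _ (dw _)) (deriveE (u i) (dw _)) (deriveE (u' i) (dw _)).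
by rewrite componentD componentZ linearP mulrBr opprD addrACA.
Qed.

End Contraction.

(** * The dual pair *)

Section Structure.
Context {R : realType} {n : nat} {M : smooth_manifold R (n * 2).+1}.
Context (omega : kfield M 1) (Omega : kfield M 2).
Context (reg : regular_acc n omega Omega).

(** A vector killed by omega and Omega kills omega /\ Omega^n, a nonzero form of
    top degree. *)
Lemma regular_acc_kernel (p : M) (y : tangent p) :
  covector omega p y = 0 -> flat Omega y = 0 -> y = 0.
Proof.
have [[wl wa _] [Wl Wa _] _ nz] := reg => wy Wy.
have [v nzv] := nz p.
apply: top_form_nondegenerate nzv _.
- apply: multilinear_wedge => //; exact: multilinear_wedge_pow.
- exact: alternating_wedge.
apply: vanishes_on_wedge => [u a ua|].
  rewrite -wy /covector; congr (omega _); apply/funext => b.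
  by rewrite (ord1 b) -(ord1 a).
apply: vanishes_on_wedge_pow; apply: (vanishes_on_head (Wl p) (Wa p)) => u u0.
have Wyu : flat Omega y (u (lift ord0 ord0)) = 0 by rewrite Wy.
rewrite -{}Wyu /flat; congr (Omega _).
rewrite [LHS]vcons_decomp u0; congr vcons; apply/funext => a.
by rewrite (ord1 a).
Qed.

Context (E : vfield M) (Lambda : bfield M).
Context (dual : dual_pair omega Omega E Lambda).

Lemma Reeb_omega p : covector omega p (E p) = 1.
Proof.
have [_ _ _ [wE _ _]] := dual; rewrite -(wE p (fun=> 0)) /covector.
congr (omega _); apply/funext => a.
by rewrite (ord1 a) vcons0.
Qed.

Lemma Reeb_flat p : flat Omega (E p) = 0.
Proof. by have [_ _ _ [_ WE _]] := dual; apply/funext => x; exact: WE. Qed.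

Lemma omega_sharp p (a : tangent p -> R) :
  scalar a -> covector omega p (sharp Lambda a) = 0.
Proof.
have [[wl _ _] _ _ _] := reg; have [_ Lb _ [_ _ wL]] := dual => sa.
have sw := covector_scalar (wl p).
by rewrite sharpP//; have [_ La _] := Lb; rewrite La// wL// oppr0.
Qed.

Lemma omega_Xfield (alpha : kfield M 1) (h : M -> R) p :
  is_form alpha -> covector omega p (Xfield E Lambda alpha h p) = h p.
Proof.
move=> [al _ _]; have [[wl _ _] _ _ _] := reg.
rewrite /Xfield addrC (covector_scalar (wl p)) Reeb_omega mulr1.
by rewrite omega_sharp ?addr0//; exact: covector_scalar.
Qed.

(** Both omega and Omega^flat take the same value on the two sides, so
    [regular_acc_kernel] applies to the difference. *)
Lemma dual_pair_decomposition p (x : tangent p) :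
  x = sharp Lambda (flat Omega x) + covector omega p x *: E p.
Proof.
have [[wl _ _] [Wl _ _] _ _] := reg; have [_ _ dualL _] := dual.
have sw := covector_scalar (wl p).
have [_ flatK] := dualL p.
set u := sharp _ _; set c := covector omega p x.
have sW : scalar (flat Omega x) by exact: flat_scalar.
have diffE : x - (u + c *: E p) = -1 *: (c *: E p + u) + x.
  by rewrite scaleN1r addrC (addrC u).
apply/eqP; rewrite -subr_eq0; apply/eqP; apply: regular_acc_kernel.
- by rewrite diffE !sw Reeb_omega omega_sharp// mulr1 addr0 mulN1r addNr.
- rewrite diffE !flat_linear// Reeb_flat scaler0 add0r /u flatK; last by exists x.
  by rewrite scaleN1r addNr.
Qed.

End Structure.

(** * Infinitesimal symmetries of omega *)

Theorem theorem2p2 (R : realType) (n : nat)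
  (M : smooth_manifold R (n * 2).+1)
  (omega : kfield M 1) (Omega : kfield M 2)
  (E : vfield M) (Lambda : bfield M)
  (reg : regular_acc n omega Omega)
  (dual : dual_pair omega Omega E Lambda)
  (X : vfield M) (Xsmooth : smooth_vfield X) :
  (forall p v, lie X omega p v = 0) <->
  exists (alpha : kfield M 1) (h : M -> R),
    [/\ is_form alpha, smooth_fun h,
        X = Xfield E Lambda alpha h &
        forall p (v : 'I_1 -> tangent p),
          interior_product (sharp_field Lambda alpha) (extd omega) p v
          + h p * interior_product E (extd omega) p v
          + extd (fun_form h) p v = 0].
Proof.
have [wf Wf _ _] := reg.
have lieE alpha h : is_form alpha -> X = Xfield E Lambda alpha h ->
    forall p v, lie X omega p v =
      interior_product (sharp_field Lambda alpha) (extd omega) p v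
      + h p * interior_product E (extd omega) p v + extd (fun_form h) p v.
  move=> af XE p v; rewrite cartan_formula//.
  have -> : (fun q => covector omega q (X q)) = h.
    by apply/funext => q; rewrite XE (omega_Xfield reg dual).
  congr (_ + _); rewrite /interior_product XE /Xfield addrC.
  by rewrite (extd1_linear _ wf) addrC.
split=> [lie0|[alpha [h [af _ XE eq0]]] p v]; last by rewrite (lieE alpha h).
pose alpha := interior_product X Omega.
pose h q := covector omega q (X q).
have af : is_form alpha by exact: is_form_interior_product.
have XE : X = Xfield E Lambda alpha h.
  apply: functional_extensionality_dep => p.
  exact: dual_pair_decomposition.
exists alpha, h; split=> // [|p v]; last by rewrite -(lieE alpha h).
apply: smooth_fun_form.
have -> : fun_form h = interior_product X omega.
  apply: functional_extensionality_dep => p; apply/funext => v.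
  rewrite /fun_form /h /covector /interior_product; congr (omega p _).
  by apply/funext => a; rewrite (ord1 a) vcons0.
exact: is_form_interior_product.
Qed.
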